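(* Let $(P,\lambda)$ be a marked poset which is strict and irredundant, with $\lambda(P^* )\subseteq\mathbb{Z}$. Let $\mathcal{L}(P)$ be the set of linear extensions $\pi=(y_1,\dots,y_N)$ of $P$ in which the marked elements appear in increasing order of their markings. Then for every integer $n\ge 0$ the number of lattice points of the dilate $n\,\mathcal{O}(P,\lambda)$ is $$\mathrm{Ehr}_{\mathcal{O}(P,\lambda)}(n)=\sum_{\pi\in\mathcal{L}(P)}\ \prod_{(a,b)}\binom{n(\lambda(b)-\lambda(a))-d+k}{k},$$ where the product runs over all pairs $(a,b)$ of marked elements that are consecutive among the marked elements in $\pi$ (so that the entries of $\pi$ strictly between $a$ and $b$ form a block of unmarked elements), $k$ is the number of elements strictly between $a$ and $b$ in $\pi$, and $d$ is the number of descents of $\pi$ occurring between $a$ and $b$.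
   Context: A marked poset $(P,\lambda)$ is a finite poset $(P,\preceq)$ together with an induced subposet $P^*\subseteq P$ of marked elements and an order-preserving marking $\lambda:P^*\to\mathbb{R}$, with $\min(P)\cup\max(P)\subseteq P^*$. It is strict if $\lambda(a)<\lambda(b)$ whenever $a\prec b$ in $P^*$, and irredundant (regular) if for every covering relation $p\prec q$ in $P$ and all $a,b\in P^*$ with $a\preceq q$ and $p\preceq b$, one has $a=b$ or $\lambda(a)<\lambda(b)$. The marked order polytope $\mathcal{O}(P,\lambda)\subseteq\mathbb{R}^{P\setminus P^*}$ is the set of all $x$ such that, setting $x_a=\lambda(a)$ for $a\in P^*$, $x_p\le x_q$ for all $p\preceq q$; its lattice points in the dilate $n\mathcal{O}(P,\lambda)$ are counted in $\mathbb{Z}^{P\setminus P^*}$. A linear extension of $P$ (with $|P|=N$) is an order-preserving bijection $P\to[N]$, identified with the sequence $(y_1,\dots,y_N)$ of elements in order. Descents are taken with respect to a fixed natural labeling $\omega:P\to[N]$ (an order-preserving bijection): $\pi=(y_1,\dots,y_N)$ has a descent at position $j$ if $\omega(y_j)>\omega(y_{j+1})$; a descent between $a$ and $b$ is one at a position $j$ with $y_j,y_{j+1}$ among the entries from $a$ to $b$ inclusive.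
   Formalization: When distinct (incomparable) marked elements have equal markings, the marked elements of π are required to appear in increasing order of marking with ties broken by the natural labeling ω; without this the formula fails, e.g. for two incomparable elements both marked 0. *)

(* Defs.v *)
From HB Require Import structures.
From mathcomp Require Import all_boot all_order all_algebra.
Set Implicit Arguments. Unset Strict Implicit. Unset Printing Implicit Defensive.
Import Order.TTheory GRing.Theory Num.Theory.
Local Open Scope ring_scope.

Section MarkedPoset.
Variable T : finType.
Variable le : rel T.

Definition is_partial_order : Prop :=
  [/\ reflexive le, antisymmetric le & transitive le].

Definition lt_po (p q : T) : bool := (p != q) && le p q.

Definition covers (p q : T) : bool :=
  lt_po p q && ~~ [exists r, lt_po p r && lt_po r q].

Definition is_minimal (p : T) : bool := [forall q, le q p ==> (q == p)].
Definition is_maximal (p : T) : bool := [forall q, le p q ==> (q == p)].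

(* marked elements P^* and the marking lambda (only its values on M matter) *)
Variables (M : {set T}) (lam : T -> int).

Definition marked_poset : Prop :=
  [/\ is_partial_order,
      (forall p, is_minimal p -> p \in M),
      (forall p, is_maximal p -> p \in M) &
      (forall a b, a \in M -> b \in M -> le a b -> lam a <= lam b)].

Definition strict_marking : Prop :=
  forall a b, a \in M -> b \in M -> lt_po a b -> lam a < lam b.

Definition irredundant : Prop :=
  forall p q, covers p q ->
  forall a b, a \in M -> b \in M -> le a q -> le p b ->
  a = b \/ lam a < lam b.

(* natural labeling omega : P -> [N] (here 'I_N, i.e. 0..N-1) *)
Definition natural_labeling (om : T -> 'I_#|T|) : Prop :=
  bijective om /\ (forall p q, le p q -> (om p <= om q)%N).

Definition is_linext (s : seq T) : bool :=
  perm_eq s (enum T) &&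
  [forall p, forall q, le p q ==> (index p s <= index q s)%N].

Definition marked_sorted (om : T -> 'I_#|T|) (s : seq T) : bool :=
  [forall a, forall b,
     [&& a \in M, b \in M & (index a s < index b s)%N] ==>
     ((lam a < lam b) || ((lam a == lam b) && (om a < om b)%N))].

Definition consec_marked (s : seq T) (a b : T) : bool :=
  [&& a \in M, b \in M, (index a s < index b s)%N &
      ~~ [exists c, [&& c \in M, (index a s < index c s)%N
                               & (index c s < index b s)%N]]].

(* number of descents of s at positions t with i <= t < j (0-based positions),
   i.e. descents among the entries from position i to position j *)
Definition ndes (om : T -> 'I_#|T|) (s : seq T) (i j : nat) : nat :=
  let w := [seq nat_of_ord (om x) | x <- s] in
  count (fun t => (nth 0%N w t.+1 < nth 0%N w t)%N) (iota i (j - i)).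

Definition binomz (R : fieldType) (m : int) (k : nat) : R :=
  (\prod_(i < k) ((m - (i : nat)%:Z)%:~R : R)) / (k`!)%:R.

Definition ehr_term (R : fieldType) (om : T -> 'I_#|T|) (n : nat) (s : seq T) : R :=
  \prod_(a : T) \prod_(b : T | consec_marked s a b)
     (let k := (index b s - index a s).-1 in
      let d := ndes om s (index a s) (index b s) in
      binomz R (n%:Z * (lam b - lam a) - d%:Z + k%:Z) k).

Definition unmarked := {x : T | x \notin M}.

Definition extend (R : numDomainType) (x : {ffun unmarked -> R}) (p : T) : R :=
  match (insub p : option unmarked) with
  | Some u => x u
  | None => (lam p)%:~R
  end.

Definition in_MOP (R : numDomainType) (x : {ffun unmarked -> R}) : Prop :=
  forall p q, le p q -> extend x p <= extend x q.

Definition lattice_pt_dilate (R : numDomainType) (n : nat)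
    (z : {ffun unmarked -> int}) : Prop :=
  exists x : {ffun unmarked -> R},
    in_MOP x /\ forall u, (z u)%:~R = n%:R * x u.

End MarkedPoset.

(* Main.v *)
Require Import Defs.
From HB Require Import structures.
From mathcomp Require Import all_boot all_order all_algebra.
From mathcomp Require Import zify ring.
Import Order.TTheory GRing.Theory Num.Theory.
Local Open Scope ring_scope.
Set Implicit Arguments. Unset Strict Implicit. Unset Printing Implicit Defensive.

(** For [n > 0], sorting the elements by (value, label) attaches to each lattice
    point of the dilate a linear extension whose marked elements are sorted.  The
    points attached to a given extension are the integer sequences with prescribed
    values at the marked entries that increase weakly, and strictly at descents;
    between consecutive marked entries they are counted by one binomial
    coefficient, by the hockey-stick identity.

    For [n = 0] there is one lattice point, and the right-hand side is a sum of
    Euler characteristics of half-open cells: the factor of a block is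
    [[d = 0] + (-1)^k [d = k + 1]].  Inserting an unmarked [p] between the
    neighbours [u], [v] of a word multiplies its weight by
    [[om u < om p] - [om v < om p]].  Summed over the gaps allowed by the order this
    telescopes to [1], since the first allowed gap follows an element below [p] and
    the last one precedes an element above [p].  So unmarked elements can be removed
    one at a time until only the sorted word of marked elements, of weight [1],
    remains. *)

(** * Blocks of a word *)

Section Blocks.
Variables (T : finType) (M : {set T}) (om : T -> 'I_#|T|).

Definition desc (x y : T) : bool := (om y < om x)%N.

(** Structural form of the positional count [ndes], suited to recursion along a block. *)
Fixpoint ndesc (x : T) (s : seq T) : nat :=
  if s is y :: r then (desc x y + ndesc y r)%N else 0%N.

Lemma ndesc_le_size x s : (ndesc x s <= size s)%N.
Proof. by elim: s x => //= y s IH x; have := IH y; case: desc; lia. Qed.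

(** If every step is a descent, the labels fall all the way from [x] to [y]. *)
Lemma ndesc_full x s y :
  ndesc x (rcons s y) = (size s).+1 -> (om y < om x)%N.
Proof.
elim: s x => [|w s IH] x /=; first by rewrite addn0 /desc; case: ltnP.
have le_w := ndesc_le_size w (rcons s y); rewrite size_rcons in le_w.
rewrite {1}/desc; case: ltnP => [lt_wx|_] /= E; last by lia.
by apply: ltn_trans (IH w _) lt_wx; lia.
Qed.

Lemma ndes_cat s t i j :
  ndes om (s ++ t) (size s + i) (size s + j) = ndes om t i j.
Proof.
rewrite /ndes subnDl iotaDl count_map; apply: eq_count => k /=.
have nthE i' : nth 0%N [seq nat_of_ord (om x) | x <- s ++ t] (size s + i') =
    nth 0%N [seq nat_of_ord (om x) | x <- t] i'.
  by rewrite map_cat nth_cat size_map ltnNge leq_addr addKn.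
by rewrite -addnS !nthE.
Qed.

Lemma ndes_ndesc x s r : ndes om (x :: s ++ r) 0 (size s) = ndesc x s.
Proof.
elim: s x => [|y s IH] x //=.
rewrite -IH -[ndes om (y :: _) _ _](ndes_cat [:: x]) /ndes /=.
by rewrite addn0 add1n subSS subn0.
Qed.

Lemma index_cat_notin (s t : seq T) x :
  x \notin s -> index x (s ++ t) = (size s + index x t)%N.
Proof. by rewrite index_cat => /negbTE->. Qed.

Lemma index_cat_lt (s t : seq T) x : (index x (s ++ t) < size s)%N = (x \in s).
Proof.
rewrite index_cat; case: ifP => [xs|_]; first by rewrite index_mem.
by rewrite ltnNge leq_addr.
Qed.

Lemma consec_marked_catr s t x y :
    uniq (s ++ t) -> x \in t -> y \in t ->
  consec_marked M (s ++ t) x y = consec_marked M t x y.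
Proof.
rewrite cat_uniq => /and3P[_ /hasPn dis _] xt yt.
have [xs ys] : x \notin s /\ y \notin s by split; apply: dis.
rewrite /consec_marked !index_cat_notin // ltn_add2l.
congr [&& _, _, _ & ~~ _]; apply: eq_existsb => z; congr (_ && _).
have [zs|zs] := boolP (z \in s); last by rewrite index_cat_notin // !ltn_add2l.
have -> : (size s + index x t < index z (s ++ t))%N = false.
  apply/negbTE; rewrite -leqNgt; apply: leq_trans (leq_addr _ _).
  by rewrite ltnW // index_cat_lt.
(* A [z] outside [t] gets index [size t] there, so it cannot precede [y] on the right-hand side
   either. *)
rewrite (@memNindex _ z t); last by apply: contraL zs => /dis.
by rewrite [X in _ = _ && X]ltnNge index_size andbF.
Qed.

Lemma consec_marked_index s x y :
  consec_marked M s x y -> (index x s < index y s)%N.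
Proof. by case/and4P. Qed.

Lemma consec_marked_head a u b r x :
    uniq (a :: u ++ b :: r) -> a \in M -> b \in M ->
    all [predC M] u -> x \in a :: u ++ b :: r ->
  consec_marked M (a :: u ++ b :: r) a x = (x == b).
Proof.
set s := a :: _ => uniq_s aM bM /allP uM xs.
have sE : s = (a :: u) ++ b :: r by [].
have ixa : index a s = 0%N by rewrite /s /= eqxx.
have nb : b \notin a :: u.
  move: uniq_s; rewrite sE cat_uniq => /and3P[_ /hasPn + _]; apply.
  exact: mem_head.
have ixb : index b s = (size u).+1.
  by rewrite sE index_cat_notin //= eqxx addn0.
have lt_u z : (index z s < (size u).+1)%N = (z \in a :: u).
  by rewrite sE -(index_cat_lt (a :: u) (b :: r)).
clearbody s; apply/idP/eqP => [|->]; last first.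
  rewrite /consec_marked aM bM ixa ixb /=; apply/existsPn => z.
  rewrite lt_u inE; apply/and3P => -[zM z0 /orP[/eqP za | /uM /=]].
    by move: z0; rewrite za ixa.
  by rewrite zM.
case/and4P=> _ xM; rewrite ixa => x0 /existsPn/(_ b).
rewrite bM ixb /= -leqNgt leq_eqVlt lt_u => /orP[/eqP E|].
  by apply: (@index_inj _ a s); rewrite ?ixb // sE mem_cat mem_head orbT.
by rewrite inE => /orP[/eqP xa|/uM /=]; [move: x0; rewrite xa ixa | rewrite xM].
Qed.

(** Induction on blocks: the first marked entry after [a] closes a block, and what follows is again
    a word with marked ends. *)
Lemma block_ind (P : T -> seq T -> Prop) :
    (forall a, a \in M -> P a [::]) ->
    (forall a u b r, a \in M -> b \in M -> all [predC M] u ->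
       P b r -> P a (u ++ b :: r)) ->
  forall a s, a \in M -> last a s \in M -> P a s.
Proof.
move=> P0 PS a s; have [m] := ubnP (size s).
elim: m a s => // m IH a s lt_m aM lastM.
have [->|s_neq0] := eqVneq s [::]; first exact: P0.
have hasM : has (mem M) s.
  apply/hasP; exists (last a s) => //.
  by case: s s_neq0 {lt_m lastM} => //= y s _; rewrite mem_last.
case: (split_find hasM) lt_m lastM => b u r bM; rewrite -all_predC => uM.
rewrite size_cat size_rcons cat_rcons last_cat /= => lt_m lastM.
by apply: PS => //; apply: IH => //; lia.
Qed.

Variable R : comRingType.
Variable G : T -> T -> nat -> nat -> R.

(** The product in [ehr_term] with an arbitrary block factor [G], taken over the word rather than
    over the type so that its first block can be split off. *)
Definition block_prod (s : seq T) : R :=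
  \prod_(a <- s) \prod_(b <- s | consec_marked M s a b)
    G a b (ndes om s (index a s) (index b s)) (index b s - index a s).-1.

Lemma block_prod1 a : block_prod [:: a] = 1.
Proof.
rewrite /block_prod !big_cons !big_nil /consec_marked ltnn.
by rewrite !andbF mulr1.
Qed.

(** The only consecutive pair starting at [a] is [(a, b)], entries of [u] start none, and for pairs
    inside [b :: r] all positions are merely shifted. *)
Lemma block_prod_cons a u b r :
    uniq (a :: u ++ b :: r) -> a \in M -> b \in M -> all [predC M] u ->
  block_prod (a :: u ++ b :: r) =
    G a b (ndesc a (rcons u b)) (size u) * block_prod (b :: r).
Proof.
move=> uniq_s aM bM uM.
have head_s x := @consec_marked_head a u b r x uniq_s aM bM uM.
set s := a :: _ in uniq_s head_s *.
have sE : s = (a :: u) ++ b :: r by [].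
have /and3P[_ /hasPn dis _] : [&& uniq (a :: u),
  ~~ has (mem (a :: u)) (b :: r) & uniq (b :: r)] by rewrite -cat_uniq -sE.
have bs : b \in s by rewrite sE mem_cat mem_head orbT.
have ixa : index a s = 0%N by rewrite /s /= eqxx.
have ixb : index b s = (size u).+1.
  by rewrite sE index_cat_notin /= ?eqxx ?addn0 //; apply/dis/mem_head.
have ndes_s : ndes om s 0 (size u).+1 = ndesc a (rcons u b).
  by rewrite /s -cat_rcons -(size_rcons u b) ndes_ndesc.
clearbody s; rewrite /block_prod {1}sE big_cat big_cons /=; congr (_ * _).
  rewrite [X in _ * X]big1_seq ?mulr1 => [|c /= cu]; last first.
    rewrite big1 // => d /and4P[cM]; have /= := allP uM c cu.
    by rewrite cM.
  rewrite big_seq_cond (eq_bigl (fun x => (x \in s) && (x == b))); last first.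
    by move=> x; case xs: (x \in s) => //=; rewrite head_s.
  rewrite -big_seq_cond -big_filter filter_pred1_uniq // big_seq1.
  by rewrite ixa ixb subn0 ndes_s.
rewrite !big_seq; apply: eq_bigr => c ct.
have cs : c \notin a :: u by apply: dis.
rewrite {1}sE big_cat /= big1_seq ?mul1r; last first.
  move=> d /andP[/consec_marked_index lt_cd du]; exfalso.
  have lt_d : (index d s < size (a :: u))%N by rewrite sE index_cat_lt.
  have := ltn_trans lt_cd lt_d; rewrite sE index_cat_lt.
  exact/negP.
rewrite big_seq_cond [RHS]big_seq_cond; apply: eq_big => d.
  case dt: (d \in b :: r); last by [].
  by rewrite !andTb sE consec_marked_catr // -sE.
case/andP=> dt _; have ds : d \notin a :: u by apply: dis.
by rewrite sE !index_cat_notin // ndes_cat subnDl.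
Qed.

End Blocks.

(** * Counting increasing sequences *)

Section Binomz.
Variable R : realFieldType.

Lemma binomz_nat (m k : nat) : binomz R m%:Z k = 'C(m, k)%:R.
Proof.
rewrite /binomz; apply: (canLR (mulfK _)); first by rewrite pnatr_eq0 -lt0n fact_gt0.
rewrite -natrM bin_ffact; have [le_km|lt_mk] := leqP k m.
  rewrite ffact_prod natr_prod; apply: eq_bigr => i _.
  by rewrite subzn ?pmulrn // ltnW // (leq_trans (ltn_ord i)).
rewrite ffact_small // (bigD1 (Ordinal lt_mk)) //= subrr mulr0z.
by rewrite mul0r.
Qed.

Lemma binomz_opp1 k : binomz R (-1) k = (-1) ^+ k.
Proof.
rewrite /binomz; apply: (canLR (mulfK _)); first by rewrite pnatr_eq0 -lt0n fact_gt0.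
elim: k => [|k IH]; first by rewrite big_ord0 expr0 mul1r.
rewrite big_ord_recr /= IH factS natrM exprS.
have -> : (-1 - k%:Z)%:~R = - (k.+1)%:R :> R.
  have -> : -1 - k%:Z = - k.+1%:Z by lia.
  by rewrite mulrNz pmulrn.
ring.
Qed.

(* Constant term of [n |-> binomz (n D - d + k) k]: the Euler characteristic
   of a half-open simplex. *)
Lemma binomz_chi d k : (d <= k.+1)%N ->
  binomz R (k%:Z - d%:Z) k = (d == 0%N)%:R + (-1) ^+ k * (d == k.+1)%:R.
Proof.
move=> le_d; have [->|d_neq] := eqVneq d k.+1.
  have -> : k%:Z - k.+1%:Z = -1 by lia.
  by rewrite binomz_opp1 add0r mulr1.
have le_dk : (d <= k)%N by lia.
rewrite subzn // binomz_nat mulr0 addr0; have [->|d0] := eqVneq d 0%N.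
  by rewrite subn0 binn.
by rewrite bin_small //; lia.
Qed.

(** The upper argument is the natural number [D + k - d]. When [D < d] it is less than [k] and the
    coefficient vanishes, which the boolean factor records. *)
Lemma binomz_trunc (D d k : nat) : (d <= D + k)%N ->
  binomz R (D%:Z - d%:Z + k%:Z) k =
    ((d <= D) * 'C(D - d + k, k))%:R.
Proof.
move=> le_d; have -> : D%:Z - d%:Z + k%:Z = (D + k - d)%:Z by lia.
rewrite binomz_nat; have [le_dD|lt_Dd] := leqP d D; rewrite /= ?mul1n.
  by rewrite addnBAC.
by rewrite bin_small //; lia.
Qed.

End Binomz.

(** * Value sequences along a word *)

Section Chains.
Variables (T : finType) (M : {set T}) (om : T -> 'I_#|T|).
Variables (mu : T -> nat) (B : nat).

(** [mu] stands for the dilated marking shifted into the natural numbers; the bound [B] keeps the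
    enumeration finite. *)
Definition next_vals (x : T) (v : nat) (y : T) : seq nat :=
  [seq c <- iota (v + desc om x y) (B.+1 - (v + desc om x y))
     | (y \in M) ==> (c == mu y)].

Fixpoint vals (x : T) (v : nat) (s : seq T) : seq (seq nat) :=
  if s is y :: r then
    [seq c :: w | c <- next_vals x v y, w <- vals y c r]
  else [:: [::]].

Definition all_vals (s : seq T) : seq (seq nat) :=
  if s is a :: r then [seq mu a :: w | w <- vals a (mu a) r] else [:: [::]].

Lemma mem_next_vals x v y c :
  (c \in next_vals x v y) =
    [&& (v + desc om x y <= c)%N, (c <= B)%N & (y \in M) ==> (c == mu y)].
Proof.
rewrite mem_filter mem_iota andbC -andbA.
case: (leqP (v + desc om x y) c) => //= le_c; congr (_ && _).
by apply/idP/idP; lia.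
Qed.

Lemma next_vals_marked x v y : y \in M -> (mu y <= B)%N ->
  next_vals x v y = nseq (v + desc om x y <= mu y)%N (mu y).
Proof.
move=> yM le_muB; rewrite /next_vals yM /=.
have U := iota_uniq (v + desc om x y) (B.+1 - (v + desc om x y)).
case: leqP => H; first by rewrite filter_pred1_uniq // mem_iota; lia.
apply/eqP; rewrite -[_ == _]negbK -has_filter; apply/hasPn => c.
rewrite mem_iota => /andP[le_c _] /=; apply/eqP; lia.
Qed.

(** Hockey-stick identity, with Pascal's rule absorbing the smallest [v]. The hypothesis makes the
    range reach past every [v] with a nonzero term. *)
Lemma sum_hockey_stick L d k lo c : (L < lo + c)%N ->
  (\sum_(v <- iota lo c) ((v + d <= L) * 'C(L - (v + d) + k, k)))%N =
  ((lo + d <= L) * 'C(L - (lo + d) + k.+1, k.+1))%N.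
Proof.
(* For an empty range the hypothesis reads [L < lo], so the boolean on the right is zero. *)
elim: c lo => [|c IH] lo lt_L; first by rewrite big_nil leqNgt; case: ltnP => //; lia.
rewrite big_cons IH; last by rewrite addSnnS.
rewrite addSn.
case: (ltngtP (lo + d)%N L) => [lt_d|//|<-]; last first.
  by rewrite subnn !add0n !binn.
have -> : (L - (lo + d) + k.+1 = (L - (lo + d).+1 + k.+1).+1)%N by lia.
by rewrite binS !mul1n addnC; congr (_ + 'C(_, _))%N; lia.
Qed.

(** The value at [b] is forced. Going back through [u], summing over the value of one more unmarked
    entry raises the lower index by one, and each descent raises the least possible value by one. *)
Lemma size_vals_block x v u b r :
    all [predC M] u -> b \in M -> (mu b <= B)%N ->
  size (vals x v (u ++ b :: r)) =
    (((v + ndesc om x (rcons u b) <= mu b) *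
       'C(mu b - (v + ndesc om x (rcons u b)) + size u, size u)) *
    size (vals b (mu b) r))%N.
Proof.
move=> + bM le_b; elim: u x v => [|y u IH] x v /= uM.
  rewrite size_allpairs_dep next_vals_marked // addn0 bin0 muln1.
  by case: leqP => _; rewrite /= ?addn0 ?mul1n ?mul0n.
case/andP: uM => yM uM; rewrite size_allpairs_dep sumnE big_map.
rewrite (eq_bigr _ (fun c _ => IH y c uM)) -big_distrl /=; congr (_ * _)%N.
rewrite /next_vals (negbTE yM) /= filter_predT.
by rewrite sum_hockey_stick ?addnA //; lia.
Qed.

Lemma size_vals x v s w : w \in vals x v s -> size w = size s.
Proof.
elim: s x v w => [|y s IH] x v w /=; first by rewrite inE => /eqP->.
by case/allpairsPdep=> c [w' [_ /IH <- ->]].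
Qed.

Lemma uniq_vals x v s : uniq (vals x v s).
Proof.
elim: s x v => //= y s IH x v; apply: allpairs_uniq_dep.
- exact/filter_uniq/iota_uniq.
- by move=> c _; apply: IH.
- by case=> c w [c' w'] _ _ /= [-> ->].
Qed.

(** The lexicographic order by value [f], then label: the value may stay constant only if the label
    does not drop. *)
Definition lex_step (f : T -> nat) : rel T :=
  [rel x y | (f x + desc om x y <= f y)%N].

(** Writing the values as [map f s] turns the condition on successive positions into a relation
    between elements. *)
Lemma mem_vals (f : T -> nat) x s :
  (map f s \in vals x (f x) s) =
    path (lex_step f) x s &&
    all (fun y => (f y <= B)%N && ((y \in M) ==> (f y == mu y))) s.
Proof.
elim: s x => //= y s IH x.
apply/allpairsPdep/idP => [[c [w [cN wV [cE wE]]]]|].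
  subst c w; move: cN wV; rewrite mem_next_vals IH.
  by case/and3P=> xy -> -> /andP[-> ->]; rewrite !andbT.
case/andP=> /andP[Rxy ps] /andP[oky oks].
exists (f y), (map f s); split; rewrite ?mem_next_vals ?IH ?ps //.
by apply/andP; split.
Qed.

Lemma size_all_vals s w : w \in all_vals s -> size w = size s.
Proof.
case: s => [|a s] /=; first by rewrite inE => /eqP->.
by case/mapP=> w' /size_vals <- ->.
Qed.

Lemma uniq_all_vals s : uniq (all_vals s).
Proof.
by case: s => //= a s; rewrite map_inj_uniq ?uniq_vals // => w w' [].
Qed.

Lemma mem_all_vals (f : T -> nat) s :
    (forall a, a \in M -> mu a <= B)%N ->
    (if s is a :: _ then a \in M else true) ->
  (map f s \in all_vals s) =
    sorted (lex_step f) s &&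
    all (fun y => (f y <= B)%N && ((y \in M) ==> (f y == mu y))) s.
Proof.
move=> le_B; case: s => //= a s aM; rewrite aM /=.
apply/mapP/idP => [[w wV [fa wE]]|].
  by move: wV; rewrite -wE -fa mem_vals fa le_B // eqxx => /andP[-> ->].
case/and3P=> ps /andP[_ /eqP fa] oks; exists (map f s); last by rewrite fa.
by rewrite -fa mem_vals ps.
Qed.

End Chains.

(** * Euler characteristics of words *)

Section Insertion.
Variable T : eqType.

Definition insert_at (p : T) (s : seq T) (g : nat) : seq T :=
  take g s ++ p :: drop g s.

(** The gap is recovered as the index of [p]. *)
Lemma insert_at_inj p (s s' : seq T) g g' :
    p \notin s -> p \notin s' -> (g <= size s)%N -> (g' <= size s')%N ->
  insert_at p s g = insert_at p s' g' -> s = s' /\ g = g'.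
Proof.
have idx (t : seq T) h : p \notin t -> (h <= size t)%N ->
    index p (insert_at p t h) = h.
  move=> pt le_h; rewrite index_cat ifN; last by apply: contra pt; apply: mem_take.
  by rewrite /= eqxx addn0 size_takel.
move=> ps ps' le_g le_g' E.
have gg : g = g' by rewrite -(idx s g) // E idx.
split=> //; subst g'; move/eqP: E; rewrite eqseq_cat ?size_takel //.
by case/andP=> /eqP E1 /eqP[E2]; rewrite -(cat_take_drop g s) E1 E2 cat_take_drop.
Qed.

(** Turns a sum over permutations of [s] into a double sum over words without [p] and gaps for
    [p]. *)
Lemma permutations_insert p (s : seq T) : uniq s -> p \in s ->
  perm_eq (permutations s)
    [seq insert_at p t g | t <- permutations (rem p s), g <- iota 0 (size s)].
Proof.
move=> us ps; have sz : (size (rem p s)).+1 = size s.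
  by rewrite size_rem // prednK //; case: (s) ps.
have pN t : t \in permutations (rem p s) -> p \notin t.
  by rewrite mem_permutations => /perm_mem->; rewrite mem_rem_uniq // inE eqxx.
have szt t : t \in permutations (rem p s) -> (size t).+1 = size s.
  by rewrite mem_permutations => /perm_size->.
apply: uniq_perm; first exact: permutations_uniq.
  apply: allpairs_uniq; rewrite ?permutations_uniq ?iota_uniq //.
  move=> _ _ /allpairsP[[t g] /= [tP gP ->]] /allpairsP[[t' g'] /= [tP' gP' ->]].
  rewrite !mem_iota /= in gP gP' * => E.
  have le_g : (g <= size t)%N by rewrite -ltnS szt.
  have le_g' : (g' <= size t')%N by rewrite -ltnS szt.
  by have [-> ->] := insert_at_inj (pN _ tP) (pN _ tP') le_g le_g' E.
move=> t; apply/idP/allpairsP => [|[[t' g] /= [t'P _ ->]]].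
  rewrite mem_permutations => pt.
  have: p \in t by rewrite (perm_mem pt).
  move: pt => /[swap] /splitPr[t1 t2] pt; exists (t1 ++ t2, size t1) => /=.
  rewrite mem_permutations mem_iota -(perm_size pt) size_cat /=.
  split; last by rewrite /insert_at take_size_cat // drop_size_cat.
    rewrite -(perm_cons p); apply: perm_trans (perm_to_rem ps).
    apply: perm_trans pt.
    by rewrite -[p :: t2]cat1s perm_sym perm_catCA.
  by rewrite -addSnnS leq_addr.
rewrite mem_permutations; move: t'P; rewrite mem_permutations => pt.
rewrite perm_sym (perm_trans (perm_to_rem ps)) // perm_sym.
by rewrite /insert_at -[p :: _]cat1s perm_catCA /= cat_take_drop perm_cons.
Qed.

Lemma pairwise_insert (r : rel T) p (s : seq T) g :
  pairwise r (insert_at p s g) =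
    [&& all (r^~ p) (take g s), all (r p) (drop g s) & pairwise r s].
Proof.
have := pairwise_cat r (take g s) (drop g s); rewrite cat_take_drop => ->.
rewrite pairwise_cat allrel_consr /= -!andbA; congr (_ && _).
by rewrite [X in _ && X]andbCA andbCA.
Qed.

End Insertion.

(** * Weights of words *)

Section Chi.
Variables (T : finType) (M : {set T}) (om : T -> 'I_#|T|) (R : comRingType).

(* The weight of a word is the product over its blocks of
   [[no descent] + (-1)^k [only descents]]; the boolean of [chi] records which of
   the two summands has been chosen for the current block. *)
Fixpoint chi (sg : bool) (x : T) (s : seq T) : R :=
  if s is y :: r then
    if desc om x y == sg then
      if y \in M then chi true y r + chi false y r
      else (-1) ^+ sg * chi sg y r
    else 0
  else (~~ sg)%:R.

Definition weight (s : seq T) : R :=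
  if s is x :: r then chi true x r + chi false x r else 1.

(** All blocks are empty, and [[d = 0] + [d = 1] = 1] for each. After the last entry only the choice
    [false] counts, so the end contributes [1] as well. *)
Lemma weight_marked s : all (mem M) s -> weight s = 1.
Proof.
case: s => //= x s /andP[_]; elim: s x => /= [x _|y s IH x /andP[-> sM]].
  by rewrite add0r.
by case: desc; rewrite /= ?addr0 ?add0r IH.
Qed.

(** Matches the two choices with the two summands of [binomz_chi]: [false] demands no descent,
    [true] a descent at every step, with a sign for each unmarked entry. *)
Lemma chi_block sg x u b r : all [predC M] u -> b \in M ->
  chi sg x (u ++ b :: r) =
    (if sg then (-1) ^+ size u * (ndesc om x (rcons u b) == (size u).+1)%:R
     else (ndesc om x (rcons u b) == 0%N)%:R) * weight (b :: r).
Proof.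
move=> + bM; elim: u x => [|y u IH] x /= uM.
  rewrite bM addn0 mul1r.
  by case: desc sg => -[] /=; rewrite ?mul1r ?mul0r.
case/andP: uM => /negbTE yM uM; rewrite yM {}IH //.
have := ndesc_le_size om y (rcons u b); rewrite size_rcons => le_sz.
case: desc sg => -[] /=; rewrite ?add1n ?add0n ?eqSS ?expr0 ?mul1r ?mul0r //.
  by rewrite expr1 [in RHS]exprS !mulrA.
by rewrite (_ : _ == _ = false) ?mulr0 ?mul0r //; apply/eqP; lia.
Qed.

(** A peak or valley at [p] mixes an ascent with a descent, which suits neither choice, and the
    factor is [0]. On a rising passage the factor is [1]; on a falling one it is [-1], the sign of
    the additional unmarked entry. *)
Lemma chi_insert p sg x l1 v l2 :
    p \notin M -> om p != om (last x l1) -> om p != om v ->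
  chi sg x (l1 ++ p :: v :: l2) =
    ((om (last x l1) < om p)%N%:R - (om v < om p)%N%:R) *
      chi sg x (l1 ++ v :: l2).
Proof.
move=> pM + pv; elim: l1 x sg => [|y l1 IH] x sg /= px; last first.
  case: eqP => _; last by rewrite mulr0.
  case: ifP => _; first by rewrite !IH // mulrDr.
  by rewrite IH // mulrCA.
rewrite (negbTE pM) /desc; set c := (if v \in M then _ else _).
have {}px : (om p != om x :> nat) by [].
have {}pv : (om p != om v :> nat) by [].
case: (ltngtP (om x) (om p)) px => // xp _;
  case: (ltngtP (om v) (om p)) pv => // vp _; case: (ltnP (om v) (om x)) => vx;
  case: sg @c => c /=; rewrite ?mulr0 ?mul0r ?subrr ?subr0 ?sub0r;
  rewrite ?expr0 ?expr1 ?mul1r ?mul0r //; lia.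
Qed.

End Chi.

(** * Linear extensions *)

Lemma pairwise_indexP (T : eqType) (r : rel T) (s : seq T) : uniq s ->
  reflect {in s &, forall x y, (index x s < index y s)%N -> r x y}
          (pairwise r s).
Proof.
move=> us; case: s us => [|x0 s0] us; first by apply: ReflectT => x.
set s := x0 :: s0 in us *; apply: (iffP (@pairwiseP _ r x0 s)) => H.
  move=> x y xs ys lt_xy; rewrite -(nth_index x0 xs) -(nth_index x0 ys).
  by apply: H; rewrite ?inE ?index_mem.
move=> i j; rewrite !inE => lt_i lt_j lt_ij.
by apply: H; rewrite ?mem_nth // !index_uniq.
Qed.

Section Extensions.
Variables (T : finType) (le : rel T) (M : {set T}) (lam : T -> int).
Variable om : T -> 'I_#|T|.
Hypothesis marked : marked_poset le M lam.
Hypothesis natural : natural_labeling le om.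

Let le_refl : reflexive le. Proof. by case: marked => -[]. Qed.
Let le_anti : antisymmetric le. Proof. by case: marked => -[]. Qed.
Let le_trans : transitive le. Proof. by case: marked => -[]. Qed.

Lemma om_inj : injective om.
Proof. by case: natural => /bij_inj. Qed.

Lemma om_lt p q : le p q -> p != q -> (om p < om q)%N.
Proof.
move=> le_pq neq_pq; rewrite ltn_neqAle (proj2 natural _ _ le_pq) andbT.
by apply: contra neq_pq => /eqP/val_inj/om_inj->.
Qed.

(** The element with least label below [p] is minimal, hence marked. *)
Lemma marked_below p : exists2 m, m \in M & le m p.
Proof.
case: (@arg_minnP T p (le^~ p) (fun q => om q : nat)) => // m le_mp min_m.
exists m => //; case: marked => _ minM _ _; apply: minM.
apply/forallP => q; apply/implyP => le_qm; apply: contraT => neq_qm.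
have := min_m q (le_trans le_qm le_mp).
by rewrite leqNgt om_lt.
Qed.

Lemma marked_above p : exists2 m, m \in M & le p m.
Proof.
case: (@arg_maxnP T p (le p) (fun q => om q : nat)) => // m le_pm max_m.
exists m => //; case: marked => _ _ maxM _; apply: maxM.
apply/forallP => q; apply/implyP => le_mq; apply: contraT => neq_qm.
have : (om q <= om m)%N := max_m q (le_trans le_pm le_mq).
by rewrite leqNgt om_lt // eq_sym.
Qed.

Definition marking_lt (x y : T) : bool :=
  (lam x < lam y) || ((lam x == lam y) && (om x < om y)%N).

(** Relates an earlier entry to a later one, so that the condition on a word is pairwise and
    survives deletion of an entry. *)
Definition admissible : rel T :=
  [rel x y | ~~ le y x && ((x \in M) && (y \in M) ==> marking_lt x y)].

Lemma linext_admissible s :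
  is_linext le s && marked_sorted M lam om s =
    perm_eq s (enum T) && pairwise admissible s.
Proof.
rewrite /is_linext -andbA; have [ps|//] := boolP (perm_eq s (enum T)).
have us : uniq s by rewrite (perm_uniq ps) enum_uniq.
have sT x : x \in s by rewrite (perm_mem ps) mem_enum.
rewrite !andTb; apply/andP/(pairwise_indexP _ us) => [[lin srt] x y _ _ lt_xy|adm].
  apply/andP; split; last first.
    apply/implyP => /andP[xM yM].
    by have /forallP/(_ y)/implyP := forallP srt x; apply; rewrite xM yM.
  apply: contraL lt_xy => le_yx; rewrite -leqNgt.
  by have /forallP/(_ x)/implyP := forallP lin y; apply.
split.
  apply/forallP => p; apply/forallP => q; apply/implyP => le_pq.
  rewrite leqNgt; apply/negP => /(adm _ _ (sT q) (sT p)) /andP[].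
  by rewrite le_pq.
apply/forallP => a; apply/forallP => b; apply/implyP => /and3P[aM bM lt_ab].
by have /andP[_ /implyP] := adm _ _ (sT a) (sT b) lt_ab; apply; rewrite aM bM.
Qed.

(** Nothing lies below the first entry or above the last, so these are minimal and maximal, hence
    marked. *)
Lemma admissible_ends x s :
    perm_eq (x :: s) (enum T) -> pairwise admissible (x :: s) ->
  x \in M /\ last x s \in M.
Proof.
move=> ps adm; have us : uniq (x :: s) by rewrite (perm_uniq ps) enum_uniq.
have sT y : y \in x :: s by rewrite (perm_mem ps) mem_enum.
move/(pairwise_indexP _ us): adm => adm.
case: marked => _ minM maxM _; split; [apply: minM | apply: maxM];
  apply/forallP => q; apply/implyP => le_q; apply: contraT => neq_q.
  have lt_xq : (index x (x :: s) < index q (x :: s))%N.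
    by rewrite /= eqxx eq_sym (negbTE neq_q).
  by have /andP[] := adm _ _ (sT x) (sT q) lt_xq; rewrite le_q.
have lastE : last x s = nth x (x :: s) (size s) by rewrite nth_last.
have ixl : index (last x s) (x :: s) = size s by rewrite lastE index_uniq /=.
have lt_ql : (index q (x :: s) < index (last x s) (x :: s))%N.
  rewrite ixl ltn_neqAle -ltnS -[(size s).+1]/(size (x :: s)) index_mem sT andbT.
  apply: contra neq_q => /eqP E; apply/eqP/(@index_inj _ x (x :: s)) => //.
  by rewrite E ixl.
by have /andP[] := adm _ _ (sT q) (sT _) lt_ql; rewrite le_q.
Qed.

(** * Total weight of the admissible words *)

Section Euler.
Variable R : comRingType.
Local Notation weight := (@weight T M om R).

Lemma weight_insert x0 p t g :
    p \notin t -> p \notin M -> (0 < g < size t)%N ->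
  weight (insert_at p t g) =
    ((om (nth x0 t g.-1) < om p)%N%:R - (om (nth x0 t g) < om p)%N%:R) *
      weight t.
Proof.
case: t => [|x s]; first by rewrite ltn0 andbF.
case: g => // g pN pM lt_g; have {}lt_g : (g < size s)%N by [].
have dom q : q \in x :: s -> om p != om q.
  by move=> qs; rewrite (inj_eq om_inj); apply: contraNneq pN => ->.
have dg : om p != om (nth x0 s g) by apply: dom; rewrite inE mem_nth ?orbT.
have lastE : last x (take g s) = nth x0 (x :: s) g.
  rewrite -nth_last size_takel; last exact: ltnW.
  case: g lt_g {dg} => [|g] lt_g /=; first by rewrite take0.
  by rewrite nth_take // (set_nth_default x0) // ltnW.
have dl : om p != om (last x (take g s)).
  by rewrite lastE; apply: dom; rewrite mem_nth //= ltnS ltnW.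
have sE : s = take g s ++ nth x0 s g :: drop g.+1 s.
  by rewrite -drop_nth // cat_take_drop.
rewrite /insert_at /= (drop_nth x0 lt_g) !chi_insert // -sE -mulrDr lastE.
by [].
Qed.

Lemma sum_weight_insert p t :
    uniq t -> p \notin t -> p \notin M -> {subset M <= t} ->
    pairwise admissible t ->
  \sum_(g <- iota 0 (size t).+1 | pairwise admissible (insert_at p t g))
     weight (insert_at p t g) = weight t.
Proof.
move=> ut pt pM Mt adm.
have pN q : q \in t -> q != p by apply: contraTneq => ->.
have windowE g : pairwise admissible (insert_at p t g) =
    all (fun q => ~~ le p q) (take g t) && all (fun q => ~~ le q p) (drop g t).
  rewrite pairwise_insert adm andbT; congr (_ && _); apply: eq_all => q /=.
    by rewrite /admissible /= (negbTE pM) andbF andbT.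
  by rewrite /admissible /= (negbTE pM) andbT.
have [m mM le_mp] := marked_below p; have [m' mM' le_pm'] := marked_above p.
(* Nothing in front of [p] may lie above it, so [p] goes at the latest just before the first entry
   above it. *)
pose hi := find (le p) t.
have has_hi : has (le p) t by apply/hasP; exists m'; rewrite ?Mt.
have lt_hi : (hi < size t)%N by rewrite -has_find.
have hiE g : (g <= size t)%N -> all (fun q => ~~ le p q) (take g t) = (g <= hi)%N.
  by move=> le_g; rewrite all_predC has_take // -leqNgt.
(* Dually, [lo] is the first gap with nothing below [p] behind it, so entry [lo.-1] lies below
   [p]. *)
have exlo : exists g, all (fun q => ~~ le q p) (drop g t).
  by exists (size t); rewrite drop_size.
have [lo lo_all lo_min] := ex_minnP exlo.
have loE g : all (fun q => ~~ le q p) (drop g t) = (lo <= g)%N.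
  apply/idP/idP => [|le_g]; first exact: lo_min.
  rewrite -(subnK le_g) -drop_drop; apply/allP => q /mem_drop.
  exact: (allP lo_all).
have lo_gt0 : (0 < lo)%N.
  rewrite lt0n; apply: contraTneq le_mp => lo0; move: lo_all.
  by rewrite lo0 drop0 => /allP/(_ m (Mt _ mM)).
have x0 : T := m.
have le_lo : le (nth x0 t lo.-1) p.
  have : ~~ all (fun q => ~~ le q p) (drop lo.-1 t) by rewrite loE; lia.
  have lt_lo : (lo.-1 < size t)%N.
    by rewrite prednK // lo_min // drop_size.
  by rewrite (drop_nth x0) //= prednK // lo_all andbT negbK.
have le_hi : le p (nth x0 t hi) by apply: nth_find.
(* Otherwise entry [hi], above [p], would come before entry [lo.-1], below [p], against
   admissibility; the two cannot coincide because [p] is not in [t]. *)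
have lt_lo_hi : (lo <= hi)%N.
  rewrite leqNgt; apply/negP => lt_hl.
  have lt_lo : (lo.-1 < size t)%N by rewrite prednK // lo_min // drop_size.
  have le_lh := le_trans le_lo le_hi => {loE hiE}.
  have neq : nth x0 t lo.-1 != nth x0 t hi.
    apply: contraTneq le_lo => E; apply/negP => le_lo.
    have E' : p = nth x0 t hi by apply: le_anti; rewrite le_hi -E.
    by move: pt; rewrite E' mem_nth.
  have hl : (hi < lo.-1)%N.
    have : hi != lo.-1 by apply: contraNneq neq => ->.
    by move/eqP; lia.
  move/(@pairwiseP _ _ x0): adm => /(_ hi lo.-1); rewrite !inE.
  by case/(_ lt_hi lt_lo hl)/andP; rewrite le_lh.
pose e i : R := (om (nth x0 t i) < om p)%N%:R.
have ins g : (lo <= g <= hi)%N -> weight (insert_at p t g) =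
    (e g.-1 - e g) * weight t.
  by move=> lo_g; apply: weight_insert => //; lia.
(* The allowed gaps are exactly those from [lo] to [hi], and over them the weights telescope. *)
rewrite -big_filter (_ : [seq _ <- _ | _] = index_iota lo hi.+1); last first.
  apply: (sorted_eq leq_trans anti_leq).
  - exact/(sorted_filter leq_trans)/iota_sorted.
  - exact: iota_sorted.
  apply: uniq_perm; rewrite ?filter_uniq ?iota_uniq // => g.
  rewrite mem_filter mem_index_iota mem_iota windowE loE add0n ltnS.
  have [le_g|lt_g] := leqP g (size t).
    by rewrite hiE // !andbT andbC ltnS.
  by rewrite !andbF; apply/esym/negP => /andP[_]; lia.
have -> : lo = lo.-1.+1 by rewrite prednK.
rewrite big_nat (eq_bigr (fun g => (e g.-1 - e g) * weight t)); last first.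
  by move=> g; rewrite prednK // => lo_g; apply: ins.
rewrite -big_nat -mulr_suml big_add1 /=.
rewrite (telescope_sumr_eq (fun k => - e k)); first last.
- by move=> k _; rewrite opprK addrC.
- by lia.
rewrite opprK addrC.
(* Entry [lo.-1] is below [p] and entry [hi] above it, so natural labels fix both end values. *)
have -> : e lo.-1 = 1.
  rewrite /e om_lt //; apply: pN; rewrite mem_nth //.
  by lia.
have -> : e hi = 0.
  by rewrite /e ltnNge (proj2 natural _ _ le_hi).
by rewrite subr0 mul1r.
Qed.

(** Marking and labels are both monotone, so on marked elements admissibility means being sorted for
    the total order by marking, then label. A single word remains. *)
Lemma sum_weight_marked s : uniq s -> s =i M ->
  \sum_(t <- permutations s | pairwise admissible t) weight t = 1.
Proof.
move=> us sM.
pose mle : rel T := [rel x y | (lam x < lam y) ||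
  ((lam x == lam y) && (om x <= om y)%N)].
have mle_tr : transitive mle.
  by move=> y x z; rewrite /mle /=; lia.
have mle_anti : antisymmetric mle.
  by move=> x y H; apply/om_inj/val_inj; move: H; rewrite /mle /=; lia.
have mle_total : total mle by move=> x y; rewrite /mle /=; lia.
have admE t : perm_eq t s -> pairwise admissible t = sorted mle t.
  move=> pt; rewrite (sorted_pairwise mle_tr).
  have ut : uniq t by rewrite (perm_uniq pt).
  have tM x : x \in t -> x \in M by rewrite (perm_mem pt) sM.
  apply/(pairwise_indexP _ ut)/(pairwise_indexP _ ut) => H x y xt yt lt_xy.
    have /andP[_] := H x y xt yt lt_xy; rewrite !tM //= /mle /marking_lt /=.
    by lia.
  have := H x y xt yt lt_xy; rewrite /mle /= => xy.
  have neq : x != y by apply: contraTneq lt_xy => ->; rewrite ltnn.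
  have neq_om : (om x != om y :> nat).
    by apply: contra neq => /eqP/val_inj/om_inj->.
  rewrite /admissible /= !tM //= /marking_lt; apply/andP; split; last first.
    by rewrite ltn_neqAle neq_om.
  apply/negP => le_yx; have := om_lt le_yx; rewrite eq_sym neq => /(_ isT).
  case: marked => _ _ _ /(_ y x (tM _ yt) (tM _ xt) le_yx); rewrite leNgt ltnNge.
  by case/orP: xy => [->|/andP[_ ->]].
have srt : pairwise admissible (sort mle s).
  by rewrite admE ?perm_sort ?sort_sorted.
rewrite -big_filter (_ : [seq _ <- _ | _] = [:: sort mle s]).
  by rewrite big_seq1 weight_marked //; apply/allP => x; rewrite mem_sort sM.
apply: perm_small_eq => //; apply: uniq_perm => //.
  exact/filter_uniq/permutations_uniq.
move=> t; rewrite mem_filter mem_permutations inE.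
apply/andP/eqP => [[adm pt]|->].
  apply: (sorted_eq mle_tr mle_anti); rewrite ?sort_sorted -?admE //.
  by rewrite perm_sym perm_sort perm_sym.
by split; rewrite ?perm_sort.
Qed.

(** Stated for every word containing the marked elements, so that unmarked ones can be removed by
    induction. *)
Lemma sum_weight s : uniq s -> {subset M <= s} ->
  \sum_(t <- permutations s | pairwise admissible t) weight t = 1.
Proof.
have [n] := ubnP (size s); elim: n s => // n IH s lt_n us Ms.
have [sM|/allPn[p ps pM]] := boolP (all (mem M) s).
  by apply: sum_weight_marked => // x; apply/idP/idP; [apply: (allP sM)|apply: Ms].
have sz : (size (rem p s)).+1 = size s.
  by rewrite size_rem // prednK //; case: (s) ps.
have ur : uniq (rem p s) by apply: rem_uniq.
have Mr : {subset M <= rem p s}.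
  move=> x xM; rewrite mem_rem_uniq // inE Ms // andbT.
  by apply: contraNneq pM => <-.
rewrite -[RHS](IH (rem p s)) //; last by rewrite -ltnS sz.
rewrite (perm_big _ (permutations_insert us ps)) /=.
rewrite big_mkcond big_allpairs_dep /= [RHS]big_mkcond /=.
rewrite !big_seq; apply: eq_bigr => t; rewrite mem_permutations => pt.
rewrite -sz -(perm_size pt) -big_mkcond; case: ifP => adm.
  apply: sum_weight_insert => //.
  - by rewrite (perm_uniq pt).
  - by rewrite (perm_mem pt) mem_rem_uniq // inE eqxx.
  - by move=> x xM; rewrite (perm_mem pt) Mr.
(* No insertion makes an inadmissible word admissible. *)
by apply: big1 => g; rewrite pairwise_insert adm !andbF.
Qed.

End Euler.
End Extensions.

(** * The counting formula *)

Section Ehrhart.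
Variables (T : finType) (le : rel T) (M : {set T}) (lam : T -> int).
Variables (om : T -> 'I_#|T|) (R : realFieldType) (n : nat).

Definition block_binomz (a b : T) (d k : nat) : R :=
  binomz R (n%:Z * (lam b - lam a) - d%:Z + k%:Z) k.

Lemma ehr_term_block_prod s : perm_eq s (enum T) ->
  ehr_term M lam R om n s = block_prod M om block_binomz s.
Proof.
move=> ps; rewrite /block_prod (perm_big _ ps) big_enum; apply: eq_bigr => a _.
by rewrite (perm_big _ ps) big_enum_cond.
Qed.

Lemma block_prod_weight a s : n = 0%N -> uniq (a :: s) ->
    a \in M -> last a s \in M ->
  block_prod M om block_binomz (a :: s) = weight M om R (a :: s).
Proof.
move=> n0 us aM lastM; move: us.
apply: (@block_ind T M (fun a s => uniq (a :: s) ->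
  block_prod M om block_binomz (a :: s) = weight M om R (a :: s))) aM lastM
  => {a s} [a aM _ | a u b r aM bM uM IH us].
  by rewrite block_prod1 /= add0r.
have ur : uniq (b :: r) by move: us; rewrite -cat_cons cat_uniq => /and3P[].
rewrite block_prod_cons // IH // [weight _ _ _ (a :: _)]/= !chi_block //.
rewrite -mulrDl; congr (_ * _); rewrite /block_binomz n0 mul0r sub0r addrC.
have := ndesc_le_size om a (rcons u b); rewrite size_rcons => le_d.
by rewrite binomz_chi // addrC.
Qed.

Variables (C : int) (mu : T -> nat) (B : nat).
Hypothesis muE : forall a, a \in M -> (mu a)%:Z = n%:Z * lam a + C.
Hypothesis mu_le : forall a, a \in M -> (mu a <= B)%N.

(** [binomz_trunc] needs [d] to be at most [n (lam b - lam a) + k]. If the markings differ, the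
    product is at least [1] and [d <= k + 1] suffices; if they agree, the labels increase and not
    all steps can be descents. *)
Lemma block_binomz_count a b d k : (0 < n)%N -> a \in M -> b \in M ->
    marking_lt lam om a b -> (d <= k.+1)%N ->
    ((om a < om b)%N -> (d <= k)%N) ->
  block_binomz a b d k =
    ((mu a + d <= mu b) * 'C(mu b - (mu a + d) + k, k))%:R.
Proof.
move=> n0 aM bM ltab le_d le_d'.
have Ea := muE aM; have Eb := muE bM.
have [D DE] : exists D : nat, n%:Z * (lam b - lam a) = D%:Z.
  exists (absz (n%:Z * (lam b - lam a))); rewrite gez0_abs // mulr_ge0 // subr_ge0.
  by case/orP: ltab => [/ltW|/andP[/eqP->]].
have mub : mu b = (mu a + D)%N by lia.
rewrite /block_binomz DE binomz_trunc.
  by rewrite mub leq_add2l subnDl.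
case/orP: ltab => [lt_ab|/andP[_ /le_d' ?]]; last by lia.
have : 0 < n%:Z * (lam b - lam a) by rewrite mulr_gt0 // subr_gt0.
by rewrite DE; lia.
Qed.

Lemma block_prod_size a s : (0 < n)%N -> uniq (a :: s) ->
    pairwise (admissible le M lam om) (a :: s) ->
    a \in M -> last a s \in M ->
  block_prod M om block_binomz (a :: s) =
    (size (all_vals M om mu B (a :: s)))%:R.
Proof.
move=> n0 us adm aM lastM; rewrite size_map; move: us adm.
apply: (@block_ind T M (fun a s => uniq (a :: s) ->
  pairwise (admissible le M lam om) (a :: s) ->
  block_prod M om block_binomz (a :: s) = (size (vals M om mu B a (mu a) s))%:R))
  aM lastM => {a s} [a aM _ _ | a u b r aM bM uM IH us adm].
  by rewrite block_prod1.
have ur : uniq (b :: r) by move: us; rewrite -cat_cons cat_uniq => /and3P[].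
have admr : pairwise (admissible le M lam om) (b :: r).
  by move: adm; rewrite -cat_cons pairwise_cat => /and3P[].
rewrite block_prod_cons // IH // size_vals_block ?mu_le // natrM; congr (_ * _).
have le_d := ndesc_le_size om a (rcons u b); rewrite size_rcons in le_d.
apply: block_binomz_count => //.
  have /andP[/allP/(_ b) + _] := adm; rewrite mem_cat mem_head orbT => /(_ isT).
  by case/andP=> _; rewrite aM bM.
move=> lt_ab; rewrite -ltnS ltn_neqAle le_d andbT; apply/eqP => /ndesc_full.
by rewrite ltnNge ltnW.
Qed.

End Ehrhart.

(** * Lattice points of a dilate *)

Section Lattice.
Variables (T : finType) (le : rel T) (M : {set T}) (lam : T -> int).

Lemma extend_unmarked (R : numDomainType) (x : {ffun unmarked M -> R}) u :
  extend lam x (val u) = x u.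
Proof. by rewrite /extend valK. Qed.

Lemma extend_marked (R : numDomainType) (x : {ffun unmarked M -> R}) a :
  a \in M -> extend lam x a = (lam a)%:~R.
Proof. by move=> aM; rewrite /extend insubN // negbK. Qed.

(** Scaling by [n > 0] is invertible and preserves order, so dilating the polytope amounts to
    dilating the marking. *)
Lemma lattice_pt_dilateP (R : realFieldType) n (z : {ffun unmarked M -> int}) :
    (0 < n)%N ->
  lattice_pt_dilate le lam R n z <->
  in_MOP le (fun p => n%:Z * lam p) z.
Proof.
move=> n0; have nR : 0 < n%:R :> R by rewrite ltr0n.
have ext (x : {ffun unmarked M -> R}) p : (forall u, (z u)%:~R = n%:R * x u :> R) ->
    (extend (fun p => n%:Z * lam p) z p)%:~R = n%:R * extend lam x p.
  move=> zx; rewrite /extend; case: insubP => [u _ _|_]; first exact: zx.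
  by rewrite intz intrM pmulrn.
split=> [[x [xO zx]] p q le_pq|zO].
  rewrite -(ler_int R) !(ext x) // ler_pM2l //; exact: xO.
pose x : {ffun unmarked M -> R} := [ffun u => (z u)%:~R / n%:R].
have zx u : (z u)%:~R = n%:R * x u :> R.
  by rewrite ffunE mulrC divfK // gt_eqF.
exists x; split=> // p q le_pq.
by rewrite -(ler_pM2l nR) -!ext // ler_int zO.
Qed.

End Lattice.

(** * Both sides of the formula *)

Section Main.
Variables (T : finType) (le : rel T) (M : {set T}) (lam : T -> int).
Variables (om : T -> 'I_#|T|) (R : realFieldType).
Hypothesis marked : marked_poset le M lam.
Hypothesis natural : natural_labeling le om.

Let extensions := [seq s <- permutations (enum T) |
  is_linext le s && marked_sorted M lam om s].

Lemma mem_extensions s : (s \in extensions) =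
  perm_eq s (enum T) && pairwise (admissible le M lam om) s.
Proof.
rewrite mem_filter mem_permutations linext_admissible -andbA.
by rewrite andbC -andbA andbb andbC.
Qed.

(** [C] sums all absolute values and so bounds each of them; shifting by [C] lands between [0] and
    [2C]. *)
Lemma shifted_marking n : exists C : nat, exists mu : T -> nat,
  (forall a, (mu a)%:Z = n%:Z * lam a + C%:Z) /\
  (forall a, mu a <= C + C)%N.
Proof.
pose C := (\sum_a absz (n%:Z * lam a)%R)%N.
have le_C a : (absz (n%:Z * lam a)%R <= C)%N by rewrite /C (bigD1 a) //= leq_addr.
exists C, (fun a => absz (n%:Z * lam a + C%:Z)).
by split=> a; have := le_C a; lia.
Qed.

(** Give each [p] the largest marking of a marked element below it. The maximum is taken after the
    shift, where [0] is a harmless default. *)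
Lemma MOP_nonempty : exists x : {ffun unmarked M -> R}, in_MOP le lam x.
Proof.
have [C [mu [muE _]]] := shifted_marking 1.
have {}muE a : (lam a = (mu a)%:Z - C%:Z) by have := muE a; lia.
pose f p := (\max_(a in M | le a p) mu a)%N.
have fE a : a \in M -> f a = mu a.
  case: marked => -[le_refl _ _] _ _ mono aM; apply/eqP; rewrite eqn_leq.
  apply/andP; split; last by apply: leq_bigmax_cond; rewrite aM le_refl.
  by apply/bigmax_leqP => b /andP[bM /(mono _ _ bM aM)]; rewrite !muE; lia.
pose x : {ffun unmarked M -> R} := [ffun u => ((f (val u))%:Z - C%:Z)%:~R].
have xE p : extend lam x p = ((f p)%:Z - C%:Z)%:~R.
  have [pM|pM] := boolP (p \in M); first by rewrite extend_marked // fE // muE.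
  by rewrite -[p]/(val (Sub p pM : unmarked M)) extend_unmarked ffunE.
exists x => p q le_pq; rewrite !xE ler_int lerD2r lez_nat.
apply/bigmax_leqP => a /andP[aM le_ap]; apply: leq_bigmax_cond.
by rewrite aM; case: marked => -[_ _ /(_ p a q)] ->.
Qed.

Lemma ehrhart_at_0 :
  \sum_(s <- extensions) ehr_term M lam R om 0 s = 1.
Proof.
rewrite -[RHS](sum_weight marked natural R (enum_uniq T)); last first.
  by move=> x _; rewrite mem_enum.
rewrite -[RHS]big_filter (_ : [seq _ <- _ | _] = extensions); last first.
  apply: eq_in_filter => s; rewrite mem_permutations => ps.
  by rewrite linext_admissible ps.
rewrite !big_seq; apply: eq_bigr => s; rewrite mem_extensions => /andP[ps adm].
rewrite ehr_term_block_prod //; case: s ps adm => [|a s] ps adm.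
  by rewrite /block_prod big_nil.
have [aM lastM] := admissible_ends marked ps adm.
by rewrite block_prod_weight // (perm_uniq ps) enum_uniq.
Qed.

(** * Positive dilates *)

Section Positive.
Variable n : nat.
Hypothesis n_gt0 : (0 < n)%N.
Variables (C : nat) (mu : T -> nat).
Hypothesis muE : forall a, (mu a)%:Z = n%:Z * lam a + C%:Z.
Hypothesis mu_le : forall a, (mu a <= C + C)%N.

Definition point_of (s : seq T) (w : seq nat) : {ffun unmarked M -> int} :=
  [ffun u => (nth 0%N w (index (val u) s))%:Z - C%:Z].

Let vals_of := all_vals M om mu (C + C).

Lemma lex_step_trans f : transitive (lex_step om f).
Proof.
move=> y x z; rewrite /lex_step /desc /=.
by case: (ltnP (om y) (om x)); case: (ltnP (om z) (om y));
  case: (ltnP (om z) (om x)); lia.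
Qed.

Lemma lex_step_anti f : antisymmetric (lex_step om f).
Proof.
move=> x y; rewrite /lex_step /desc /= => H.
apply/(om_inj natural)/val_inj => /=; move: H.
by case: (ltngtP (om x) (om y)) => //= _; lia.
Qed.

Lemma lex_step_total f : total (lex_step om f).
Proof.
move=> x y; rewrite /lex_step /desc /=.
by case: (ltngtP (om x) (om y)); lia.
Qed.

Lemma extensions_head s : s \in extensions ->
  if s is a :: _ then a \in M else true.
Proof.
rewrite mem_extensions => /andP[]; case: s => // a s ps adm.
by have [] := admissible_ends marked ps adm.
Qed.

(** As [s] has no repetitions, [w] is the list of values of [f] along [s]; by the last clause [f]
    depends on the point alone. *)
Lemma vals_ofP s w : s \in extensions -> w \in vals_of s ->
  let f x := nth 0%N w (index x s) in
  [/\ w = map f s, sorted (lex_step om f) s &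
      forall p, (f p)%:Z - C%:Z =
        extend (fun p => n%:Z * lam p) (point_of s w) p].
Proof.
move=> sE ws f; have := sE; rewrite mem_extensions => /andP[ps _].
have us : uniq s by rewrite (perm_uniq ps) enum_uniq.
have wE : w = map f s.
  apply: (@eq_from_nth _ 0%N) => [|i]; rewrite (size_all_vals ws) ?size_map // => lt_i.
  have x0 : T by case: (s) lt_i.
  by rewrite (nth_map x0) // /f index_uniq.
move: ws; rewrite {1}wE mem_all_vals //; last exact: extensions_head.
case/andP=> srt /allP ok; split=> // p.
have [pM|pM] := boolP (p \in M).
  have /ok/andP[_] : p \in s by rewrite (perm_mem ps) mem_enum.
  by rewrite pM extend_marked // => /eqP->; rewrite muE addrK intz.
by rewrite -[p in RHS]/(val (Sub p pM : unmarked M)) extend_unmarked ffunE.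
Qed.

Definition points : seq {ffun unmarked M -> int} :=
  [seq point_of s w | s <- extensions, w <- vals_of s].

(** A point determines [f], and [f] determines [s] as the only sorting by value and label. *)
Lemma points_uniq : uniq points.
Proof.
apply: allpairs_uniq_dep; first exact/filter_uniq/permutations_uniq.
  by move=> s _; apply: uniq_all_vals.
move=> _ _ /allpairsPdep[s [w [sE ws ->]]] /allpairsPdep[t [v [tE vt ->]]] /= E.
have [wE ss fE] := vals_ofP sE ws; have [vE st gE] := vals_ofP tE vt.
have fg : (fun x => nth 0%N w (index x s)) =1 (fun x => nth 0%N v (index x t)).
  by move=> x; have := fE x; rewrite E -gE; lia.
have {}ss : sorted (lex_step om (fun x => nth 0%N v (index x t))) s.
  by rewrite -(eq_sorted (e := lex_step om (fun x => nth 0%N w (index x s)))) //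
    => x y; rewrite /lex_step /= !fg.
have stE : s = t.
  apply: (sorted_eq (@lex_step_trans _) (@lex_step_anti _)) ss st _.
  move: sE tE; rewrite !mem_extensions => /andP[ps _] /andP[pt _].
  by rewrite (perm_trans ps) // perm_sym.
subst t; suff -> : w = v by [].
by rewrite wE vE; apply: eq_map.
Qed.

Lemma mem_points z : z \in points <-> lattice_pt_dilate le lam R n z.
Proof.
rewrite (lattice_pt_dilateP _ _ R _ n_gt0).
split=> [/allpairsPdep[s [w [sE ws ->]]] p q le_pq|zO].
  have [_ srt fE] := vals_ofP sE ws; rewrite -!fE lerD2r lez_nat.
  move: sE; rewrite mem_extensions => /andP[ps adm].
  have us : uniq s by rewrite (perm_uniq ps) enum_uniq.
  have sT x : x \in s by rewrite (perm_mem ps) mem_enum.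
  have [->//|neq_pq] := eqVneq p q.
  move: srt; rewrite (sorted_pairwise (@lex_step_trans _)) => /(pairwise_indexP _ us) srt.
  move/(pairwise_indexP _ us): adm => adm.
  case: (ltngtP (index p s) (index q s)) => [lt_pq|lt_qp|E].
  - by apply: leq_trans (srt p q (sT p) (sT q) lt_pq); apply: leq_addr.
  - by have /andP[] := adm q p (sT q) (sT p) lt_qp; rewrite le_pq.
  - by rewrite E.
(* Conversely, a lattice point yields the word that sorts all elements by value and label. *)
pose F := extend (fun p => n%:Z * lam p) z.
have FM a : a \in M -> F a = (mu a)%:Z - C%:Z.
  by move=> aM; rewrite /F extend_marked // muE addrK intz.
(* Each value lies between those of a marked element below and one above, hence between [0] and [2C]
   after the shift. *)
pose f p := absz (F p + C%:Z).
have fE p : (f p)%:Z = F p + C%:Z.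
  have [m mM le_mp] := marked_below marked natural p.
  by have : F m <= F p := zO _ _ le_mp; rewrite (FM m mM) /f; lia.
have f_le p : (f p <= C + C)%N.
  have [m mM le_pm] := marked_above marked natural p.
  have : F p <= F m := zO _ _ le_pm; rewrite (FM m mM) => le_F.
  by have := fE p; have := mu_le m; lia.
have fM a : a \in M -> f a = mu a by move=> /FM; have := fE a; lia.
pose s := sort (lex_step om f) (enum T).
have ps : perm_eq s (enum T) by rewrite perm_sort.
have us : uniq s by rewrite (perm_uniq ps) enum_uniq.
have sT x : x \in s by rewrite (perm_mem ps) mem_enum.
have srt : sorted (lex_step om f) s by apply: sort_sorted; apply: lex_step_total.
have sE : s \in extensions.
  rewrite mem_extensions ps; apply/(pairwise_indexP _ us) => x y xs ys lt_xy.
  move: srt; rewrite (sorted_pairwise (@lex_step_trans _)).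
  move=> /(pairwise_indexP _ us)/(_ x y xs ys lt_xy); rewrite /lex_step /= => xy.
  have neq_xy : x != y by apply: contraTneq lt_xy => ->; rewrite ltnn.
  (* If [y] were below [x], the step from [x] to [y] would be a descent and force [F x < F y],
     against monotonicity. *)
  apply/andP; split.
    apply/negP => le_yx; have : F y <= F x := zO _ _ le_yx.
    have := om_lt natural le_yx; rewrite eq_sym => /(_ neq_xy) lt_om.
    by move: xy; rewrite /desc lt_om; have := fE x; have := fE y; lia.
  apply/implyP => /andP[xM yM]; rewrite /marking_lt; move: xy.
  rewrite /desc !fM // => xy; have Ex := muE x; have Ey := muE y.
  have [//|le_yx/=] := ltP (lam x) (lam y).
  (* If the marking does not increase, the step condition forces equal dilated markings; cancelling
     [n] leaves a tie, which the labels break. *)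
  have le_n : n%:Z * lam y <= n%:Z * lam x by rewrite ler_wpM2l.
  have eq_n : n%:Z * lam x = n%:Z * lam y by lia.
  have n_neq0 : n%:Z != 0 by lia.
  move/(mulfI n_neq0): eq_n => ->; rewrite eqxx /=.
  have neq_om : (om x != om y :> nat).
    by apply: contra neq_xy => /eqP/val_inj/(om_inj natural)->.
  rewrite ltn_neqAle neq_om leqNgt /=; apply/negP => lt_om.
  by move: xy; rewrite lt_om; lia.
apply/allpairsPdep; exists s, (map f s); split=> //.
  rewrite /vals_of mem_all_vals //; last exact: extensions_head.
  rewrite srt; apply/allP => y _; rewrite f_le; apply/implyP => yM.
  by rewrite fM.
apply/ffunP => u; rewrite ffunE (nth_map (val u)) ?index_mem // nth_index //.
by rewrite fE addrK /F extend_unmarked.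
Qed.

Lemma size_points :
  (size points)%:R = \sum_(s <- extensions) ehr_term M lam R om n s.
Proof.
rewrite size_allpairs_dep sumnE big_map natr_sum !big_seq.
apply: eq_bigr => s sE; have := sE; rewrite mem_extensions => /andP[ps adm].
rewrite ehr_term_block_prod // /vals_of; case: s ps adm {sE} => [|a s] ps adm.
  by rewrite /block_prod big_nil.
have [aM lastM] := admissible_ends marked ps adm.
have us : uniq (a :: s) by rewrite (perm_uniq ps) enum_uniq.
by rewrite (@block_prod_size T le M lam om R n C mu (C + C)).
Qed.

End Positive.
End Main.

Theorem theorem6p4 (T : finType) (le : rel T) (M : {set T}) (lam : T -> int)
    (om : T -> 'I_#|T|) (R : realFieldType) (n : nat) :
  marked_poset le M lam ->
  strict_marking le M lam ->
  irredundant le M lam ->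
  natural_labeling le om ->
  exists s : seq {ffun unmarked M -> int},
    [/\ uniq s,
        (forall z, z \in s <-> @lattice_pt_dilate T le M lam R n z) &
        (size s)%:R =
          \sum_(pi <- permutations (enum T) |
                  is_linext le pi && marked_sorted M lam om pi)
             ehr_term M lam R om n pi].
Proof.
move=> marked _ _ natural; rewrite -big_filter.
case: n => [|n].
  (* The zeroth dilate of a nonempty polytope is the origin alone. *)
  exists [:: [ffun=> 0]]; split=> // [z|]; last by rewrite ehrhart_at_0.
  rewrite inE; split=> [/eqP->|[x [_ zx]]].
    have [x xO] := MOP_nonempty R marked; exists x; split=> // u.
    by rewrite ffunE mul0r.
  apply/eqP/ffunP => u; apply: (@intr_inj R).
  by rewrite zx ffunE mul0r.
have [C [mu [muE mu_le]]] := shifted_marking lam n.+1.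
exists (points le M lam om C mu); split.
- exact: (points_uniq marked natural (ltn0Sn n) muE mu_le).
- exact: (mem_points R marked natural (ltn0Sn n) muE mu_le).
- exact: (size_points om R marked (ltn0Sn n) muE mu_le).
Qed.
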